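(* Let $G=(V,E)$ be an undirected graph of order $n$ and size $m$, with vertex set $V=\{v_1,\dots,v_n\}$, and let $A_G$ be its adjacency matrix. For $\lambda>0$, define the $n\times n$ matrix $R_\lambda=[r_{ij}]_{1\le i,j\le n}$ by $$r_{ij}=\begin{cases}|N_G(v_i)\cap N_G(v_j)| & \text{if } i\neq j,\\[2pt] \dfrac1\lambda+\deg v_i & \text{if } i=j.\end{cases}$$ Then $R_\lambda$ is nonsingular for all $\lambda>0$, and the Moore-Penrose generalized inverse of $A_G$ is $A_G^\dagger=[s_{ij}]_{1\le i,j\le n}$, where $$s_{ij}=s_{ji}=\lim_{\lambda\to+\infty}\langle R_\lambda^{-1}e_j,f_i\rangle\qquad(1\le i,j\le n).$$
   Context: The order of $G$ is its (finite) number of vertices and the size is its number of edges. The adjacency matrix of $G$ is the $n\times n$ matrix $A_G=[a_{ij}]$ with $a_{ij}=1$ if $v_iv_j\in E$ and $a_{ij}=0$ otherwise; it is symmetric because $G$ is undirected. For $v\in V$, $N_G(v)=\{u : uv\in E\}$ is the set of neighbours of $v$, and $\deg v=|N_G(v)|$. The set $\{e_1,\dots,e_n\}$ is the standard basis of $\mathbb{R}^n$, and $\langle\cdot,\cdot\rangle$ and $\|\cdot\|$ are the standard inner product and norm on $\mathbb{R}^n$. For $i=1,\dots,n$, $f_i=(\delta_{v_i}(v_1),\delta_{v_i}(v_2),\dots,\delta_{v_i}(v_n))\in\mathbb{R}^n$, where $\delta_u(v)=1$ if $uv\in E$ and $\delta_u(v)=0$ if $uv\notin E$. The Moore-Penrose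 generalized inverse of $A_G$ is the $n\times n$ real matrix $A_G^\dagger$ such that for each $y\in\mathbb{R}^n$: (1) $\|A_GA_G^\dagger y-y\|\le\|A_Gx-y\|$ for all $x\in\mathbb{R}^n$; and (2) if $z\in\mathbb{R}^n$ satisfies $\|A_Gz-y\|\le\|A_Gx-y\|$ for all $x\in\mathbb{R}^n$, then $\|A_G^\dagger y\|\le\|z\|$. *)

(* Defs.v *)
From mathcomp Require Import all_boot all_order all_algebra.
From mathcomp Require Import all_classical all_reals all_analysis.

Set Implicit Arguments.
Unset Strict Implicit.
Unset Printing Implicit Defensive.

Import Order.TTheory GRing.Theory Num.Theory.
Import numFieldNormedType.Exports.

Local Open Scope ring_scope.

(* Edges are unordered pairs of vertices, so the graph is undirected by
   construction; a singleton edge [set u] is a loop at u.  Simple graphs are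
   those whose edges all have cardinality 2. *)
Record ugraph (V : finType) := UGraph {
  edges : {set {set V}};
  edges_card : forall e : {set V}, e \in edges -> (0 < #|e| <= 2)%N
}.

Definition adjacent (V : finType) (G : ugraph V) (u w : V) : bool :=
  [set u; w]%SET \in edges G.

Definition neighbours (V : finType) (G : ugraph V) (u : V) : {set V} :=
  [set w : V | adjacent G u w]%SET.

Definition degree (V : finType) (G : ugraph V) (u : V) : nat :=
  #|neighbours G u|.

Definition adjacency_mx (R : realType) (V : finType) (G : ugraph V) (n : nat)
    (v : 'I_n -> V) : 'M[R]_n :=
  \matrix_(i, j) (adjacent G (v i) (v j))%:R.

(* The norm `|x| of the library is the sup norm on matrices, hence the explicit
   Euclidean structure. *)
Definition inner (R : realType) (n : nat) (x y : 'cV[R]_n) : R :=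
  \sum_(k < n) x k 0 * y k 0.

Definition enorm (R : realType) (n : nat) (x : 'cV[R]_n) : R :=
  Num.sqrt (inner x x).

Definition std_basis (R : realType) (n : nat) (j : 'I_n) : 'cV[R]_n :=
  delta_mx j 0.

Definition delta_vec (R : realType) (V : finType) (G : ugraph V) (n : nat)
    (v : 'I_n -> V) (i : 'I_n) : 'cV[R]_n :=
  \col_k (adjacent G (v i) (v k))%:R.

Definition R_mx (R : realType) (V : finType) (G : ugraph V) (n : nat)
    (v : 'I_n -> V) (lambda : R) : 'M[R]_n :=
  \matrix_(i, j)
    if i == j then lambda^-1 + (degree G (v i))%:R
    else #|neighbours G (v i) :&: neighbours G (v j)|%:R.

Definition least_squares_solution (R : realType) (n : nat) (A : 'M[R]_n)
    (y z : 'cV[R]_n) : Prop :=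
  forall x : 'cV[R]_n, enorm (A *m z - y) <= enorm (A *m x - y).

Definition is_moore_penrose (R : realType) (n : nat) (A B : 'M[R]_n) : Prop :=
  forall y : 'cV[R]_n,
    least_squares_solution A y (B *m y) /\
    (forall z : 'cV[R]_n, least_squares_solution A y z ->
       enorm (B *m y) <= enorm z).

(* Main.v *)
Require Import Defs.
From mathcomp Require Import all_boot all_order all_algebra.
From mathcomp Require Import all_classical all_reals all_analysis.

Set Implicit Arguments.
Unset Strict Implicit.
Unset Printing Implicit Defensive.

Import Order.TTheory GRing.Theory Num.Theory.
Import numFieldNormedType.Exports.

(** With eps = 1 / lambda, counting common neighbours turns [R_mx] into the
ridge matrix M = eps I + A^2, where A is the adjacency matrix; this covers
graphs with loops too, since the degree is the number of neighbours.  The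
identity <x, M x> = eps |x|^2 + |A x|^2 makes M nonsingular, and the quantity
in the statement is the (i, j) entry of A M^-1.

The limit is identified purely algebraically, without the spectral theorem.  As
A is symmetric, A and A^2 have the same kernel, so A = Y A^2 for some Y, and
B = Y A Y^T is a symmetric matrix which commutes with A and satisfies A B A = A
and B A B = B ([sym_pinv_exists]).  Two applications of Pythagoras show that B
is the unique Moore-Penrose inverse ([sym_pinv_moore_penrose]): residuals
split along the range of A, and solutions split along its kernel.

Finally A M^-1 = B - eps B^3 (I - eps M^-1) ([ridge_error]).  The same energy
identity, tested on the columns of M^-1, bounds every entry of eps M^-1 by 1
([ridge_inv_bound]), so the error is O(eps), that is O(1 / lambda). *)

Local Open Scope classical_set_scope.
Local Open Scope ring_scope.

(** * The Euclidean inner product *)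

Lemma innerE (R : realType) (n : nat) (x y : 'cV[R]_n) :
  inner x y = (x^T *m y) 0 0.
Proof. by rewrite mxE; apply: eq_bigr => k _; rewrite mxE. Qed.

Lemma innerC (R : realType) (n : nat) (x y : 'cV[R]_n) : inner x y = inner y x.
Proof. by apply: eq_bigr => k _; rewrite mulrC. Qed.

Lemma innerDr (R : realType) (n : nat) (x y z : 'cV[R]_n) :
  inner x (y + z) = inner x y + inner x z.
Proof. by rewrite !innerE mulmxDr mxE. Qed.

Lemma innerZr (R : realType) (n : nat) (a : R) (x y : 'cV[R]_n) :
  inner x (a *: y) = a * inner x y.
Proof. by rewrite !innerE -scalemxAr mxE. Qed.

Lemma inner_mulmxl (R : realType) (n : nat) (A : 'M[R]_n) (x y : 'cV[R]_n) :
  inner (A *m x) y = inner x (A^T *m y).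
Proof. by rewrite !innerE trmx_mul mulmxA. Qed.

Lemma inner_std_basis (R : realType) (n : nat) (j : 'I_n) (x : 'cV[R]_n) :
  inner x (std_basis R j) = x j 0.
Proof. by rewrite innerE -colE !mxE. Qed.

Lemma inner_ge0 (R : realType) (n : nat) (x : 'cV[R]_n) : 0 <= inner x x.
Proof. by apply: sumr_ge0 => k _; rewrite -expr2 sqr_ge0. Qed.

Lemma sqr_coord_le_inner (R : realType) (n : nat) (x : 'cV[R]_n) (k : 'I_n) :
  x k 0 ^+ 2 <= inner x x.
Proof.
rewrite /inner (bigD1 k) //= expr2 lerDl.
by apply: sumr_ge0 => i _; rewrite -expr2 sqr_ge0.
Qed.

Lemma inner_le0 (R : realType) (n : nat) (x : 'cV[R]_n) :
  inner x x <= 0 -> x = 0.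
Proof.
move=> x0; apply/colP => k; rewrite mxE; apply/eqP.
rewrite -sqrf_eq0 eq_le sqr_ge0 andbT.
exact: le_trans (sqr_coord_le_inner x k) x0.
Qed.

Lemma enorm_le (R : realType) (n : nat) (x y : 'cV[R]_n) :
  (enorm x <= enorm y) = (inner x x <= inner y y).
Proof. by rewrite /enorm ler_sqrt // inner_ge0. Qed.

Lemma inner_pythagoras (R : realType) (n : nat) (x y : 'cV[R]_n) :
  inner x y = 0 -> inner (x + y) (x + y) = inner x x + inner y y.
Proof.
move=> xy0; rewrite innerDr ![inner (x + y) _]innerC !innerDr.
by rewrite [inner y x]innerC xy0 addr0 add0r.
Qed.

Lemma gram_eq0 (R : realType) (m n : nat) (M : 'M[R]_(m, n)) :
  M^T *m M = 0 -> M = 0.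
Proof.
move=> MM0; apply/matrixP => i j.
suff /inner_le0 /colP /(_ i) : inner (col j M) (col j M) <= 0 by rewrite !mxE.
suff -> : inner (col j M) (col j M) = (M^T *m M) j j by rewrite MM0 mxE.
by rewrite mxE; apply: eq_bigr => k _; rewrite !mxE.
Qed.

(** * The Moore-Penrose inverse of a symmetric matrix *)

(** The columns of a cokernel C of A^2 satisfy A^2 C = 0, hence
(A C)^T (A C) = C^T A^2 C = 0 and A C = 0; thus the rows of A lie in the row
space of A^2. *)
Lemma sym_factor_sqr (R : realType) (n : nat) (A : 'M[R]_n) :
  A^T = A -> exists Y, A = Y *m (A *m A).
Proof.
move=> symA; apply/submxP; rewrite submxE; apply/eqP/gram_eq0.
by rewrite trmx_mul symA -mulmxA [A *m (A *m _)]mulmxA mulmx_coker mulmx0.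
Qed.

(** The Penrose equations for symmetric A: the Moore-Penrose inverse is then
itself symmetric, so that the symmetry of A B and of B A, which the equations
require, amounts to A B = B A. *)
Definition sym_pinv (R : realType) (n : nat) (A B : 'M[R]_n) : Prop :=
  [/\ B^T = B, A *m B = B *m A, A *m B *m A = A & B *m A *m B = B].

(** From A = Y A^2 and its transpose A = A^2 Y^T one gets Y A = A Y^T, and this
matrix is the orthogonal projection onto the range of A. *)
Lemma sym_pinv_exists (R : realType) (n : nat) (A : 'M[R]_n) :
  A^T = A -> exists B, sym_pinv A B.
Proof.
move=> symA; have [Y AY] := sym_factor_sqr symA.
have AX : A = A *m A *m Y^T by rewrite -[LHS]symA [in LHS]AY !trmx_mul symA.
have YA_AX : Y *m A = A *m Y^T.
  by rewrite [in LHS]AX [in RHS]AY !mulmxA.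
have YAA : Y *m A *m A = A by rewrite -mulmxA -AY.
have AB : A *m (Y *m A *m Y^T) = A *m Y^T.
  by rewrite YA_AX !mulmxA -AX.
have BA : Y *m A *m Y^T *m A = A *m Y^T.
  by rewrite -[in LHS](mulmxA Y) -YA_AX -!mulmxA -AY YA_AX.
exists (Y *m A *m Y^T); split.
- by rewrite !trmx_mul trmxK symA mulmxA.
- by rewrite AB BA.
- by rewrite AB -YA_AX YAA.
- by rewrite BA -YA_AX -mulmxA AB mulmxA.
Qed.

(** B y lies in the range of A, which is the orthogonal complement of the kernel
of A, and x - B y lies in that kernel. *)
Lemma sym_pinv_decomp (R : realType) (n : nat) (A B : 'M[R]_n)
    (x y : 'cV[R]_n) :
  A^T = A -> sym_pinv A B -> A *m x = A *m (B *m y) ->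
  inner x x = inner (B *m y) (B *m y) + inner (x - B *m y) (x - B *m y).
Proof.
move=> symA [_ AB_BA _ BAB] Ax; set b := B *m y; set d := x - b.
have Ad : A *m d = 0 by rewrite /d mulmxBr Ax subrr.
rewrite -inner_pythagoras; first by rewrite /d addrC subrK.
rewrite /b -BAB -AB_BA -!mulmxA inner_mulmxl symA.
by rewrite Ad innerE mulmx0 mxE.
Qed.

(** A B is the orthogonal projection onto the range of A. *)
Lemma sym_pinv_residual_orth (R : realType) (n : nat) (A B : 'M[R]_n)
    (x y : 'cV[R]_n) :
  A^T = A -> sym_pinv A B ->
  inner (A *m (B *m y) - y) (A *m x) = 0.
Proof.
move=> symA [_ AB_BA ABA _].
rewrite innerC inner_mulmxl symA mulmxBr !mulmxA -[A *m A *m B]mulmxA AB_BA.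
by rewrite mulmxA ABA subrr innerE mulmx0 mxE.
Qed.

Lemma sym_pinv_residual (R : realType) (n : nat) (A B : 'M[R]_n)
    (x y : 'cV[R]_n) :
  A^T = A -> sym_pinv A B ->
  inner (A *m x - y) (A *m x - y) =
    inner (A *m (B *m y) - y) (A *m (B *m y) - y)
    + inner (A *m (x - B *m y)) (A *m (x - B *m y)).
Proof.
move=> symA pAB; rewrite -inner_pythagoras; last exact: sym_pinv_residual_orth.
by rewrite mulmxBr [_ - y + _]addrC addrA subrK.
Qed.

Lemma sym_pinv_least_squares (R : realType) (n : nat) (A B : 'M[R]_n)
    (y z : 'cV[R]_n) :
  A^T = A -> sym_pinv A B ->
  least_squares_solution A y z <-> A *m z = A *m (B *m y).
Proof.
move=> symA pAB; split=> [lsq_z | Az x].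
  apply/eqP; rewrite -subr_eq0 -mulmxBr; apply/eqP/inner_le0.
  have := lsq_z (B *m y).
  by rewrite enorm_le (sym_pinv_residual z y symA pAB) gerDl.
by rewrite Az enorm_le (sym_pinv_residual x y symA pAB) lerDl inner_ge0.
Qed.

(** Any Moore-Penrose inverse C yields a least squares solution C y no longer
than B y; since |C y|^2 = |B y|^2 + |C y - B y|^2, the two agree. *)
Lemma sym_pinv_moore_penrose (R : realType) (n : nat) (A B : 'M[R]_n) :
  A^T = A -> sym_pinv A B -> unique (is_moore_penrose A) B.
Proof.
move=> symA pAB.
have mpB : is_moore_penrose A B.
  move=> y; split=> [|z]; first by rewrite (sym_pinv_least_squares _ _ symA pAB).
  rewrite (sym_pinv_least_squares _ _ symA pAB) enorm_le.
  by move=> /(sym_pinv_decomp symA pAB) ->; rewrite lerDl inner_ge0.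
split=> // C mpC; apply/matrixP => i j.
have [lsqC minC] := mpC (std_basis R j).
have [lsqB _] := mpB (std_basis R j).
have := minC _ lsqB; rewrite enorm_le.
have /(sym_pinv_decomp symA pAB) -> :=
  (sym_pinv_least_squares _ _ symA pAB).1 lsqC.
rewrite gerDl => /inner_le0 /eqP; rewrite subr_eq0 -!colE => /eqP /colP /(_ i).
by rewrite !mxE.
Qed.

(** * Ridge regularization *)

Definition ridge (R : realType) (n : nat) (A : 'M[R]_n) (eps : R) : 'M[R]_n :=
  eps%:M + A *m A.

Lemma inner_ridge (R : realType) (n : nat) (A : 'M[R]_n) (eps : R)
    (x : 'cV[R]_n) :
  A^T = A ->
  inner x (ridge A eps *m x) = eps * inner x x + inner (A *m x) (A *m x).
Proof.
move=> symA; rewrite /ridge mulmxDl mul_scalar_mx innerDr innerZr.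
by rewrite [inner (A *m x) _]inner_mulmxl symA mulmxA.
Qed.

Lemma ridge_unitmx (R : realType) (n : nat) (A : 'M[R]_n) (eps : R) :
  A^T = A -> 0 < eps -> ridge A eps \in unitmx.
Proof.
move=> symA eps0; rewrite -row_full_unit -cokermx_eq0; apply/eqP/matrixP => i j.
suff /colP /(_ i) : col j (cokermx (ridge A eps)) = 0 by rewrite !mxE.
set x := col j _.
have Mx : ridge A eps *m x = 0 by rewrite /x colE mulmxA mulmx_coker mul0mx.
apply: inner_le0; rewrite -(pmulr_rle0 _ eps0).
have := inner_ridge eps x symA; rewrite Mx innerE mulmx0 mxE => ->.
by rewrite lerDl inner_ge0.
Qed.

(** Let u be the j-th column of M^-1.  The energy identity gives
eps |u|^2 <= <u, M u> = u_j, hence (eps u_k)^2 <= eps u_j for all k.  The case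
k = j forces eps u_j <= 1, and then every k follows. *)
Lemma ridge_inv_bound (R : realType) (n : nat) (A : 'M[R]_n) (eps : R)
    (k j : 'I_n) :
  A^T = A -> 0 < eps -> `|eps * invmx (ridge A eps) k j| <= 1.
Proof.
move=> symA eps0; set M := ridge A eps.
pose u : 'cV[R]_n := invmx M *m std_basis R j.
have uE l : u l 0 = invmx M l j by rewrite /u -colE mxE.
have energy : eps * inner u u <= u j 0.
  have := inner_ridge eps u symA.
  rewrite mulKVmx ?ridge_unitmx // inner_std_basis => ->.
  by rewrite lerDl inner_ge0.
have coord l : (eps * u l 0) ^+ 2 <= eps * u j 0.
  rewrite exprMn expr2 -mulrA ler_pM2l //; apply: le_trans energy.
  by rewrite ler_pM2l // sqr_coord_le_inner.
have epsuj : eps * u j 0 <= 1.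
  have uj0 : 0 <= eps * u j 0 by apply: le_trans (coord j); exact: sqr_ge0.
  rewrite leNgt; apply/negP => uj1; have := coord j.
  by rewrite leNgt expr2 ltr_pMr ?uj1 // (lt_trans ltr01).
rewrite -uE -(@expr_le1 _ 2) //.
by rewrite real_normK ?num_real // (le_trans (coord k)).
Qed.

(** Since B A^2 = A, one has B M = eps B + A, so A M^-1 = B (I - eps M^-1).  The
error eps B M^-1 carries a factor eps that is not yet known to be useful, as
M^-1 may blow up like 1 / eps on the kernel of A; writing B = B^2 A and using
the formula for A M^-1 once more gives eps B^3 (I - eps M^-1), where only the
bounded matrix eps M^-1 remains. *)
Lemma ridge_error (R : realType) (n : nat) (A B : 'M[R]_n) (eps : R) :
  A^T = A -> sym_pinv A B -> 0 < eps ->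
  A *m invmx (ridge A eps) =
    B - eps *: (B *m B *m B *m (1%:M - eps *: invmx (ridge A eps))).
Proof.
move=> symA [_ AB_BA ABA BAB] eps0.
have uM := ridge_unitmx symA eps0; set M := ridge A eps in uM *.
have BAA : B *m (A *m A) = A by rewrite mulmxA -AB_BA ABA.
have BM : B *m M = eps *: B + A by rewrite mulmxDr mul_mx_scalar BAA.
have AMi : A *m invmx M = B *m (1%:M - eps *: invmx M).
  rewrite mulmxBr mulmx1 -scalemxAr.
  have {1}-> : B = A *m invmx M + eps *: (B *m invmx M).
    by rewrite scalemxAl -mulmxDl addrC -BM mulmxK.
  by rewrite addrK.
have BBA : B *m B *m A = B by rewrite -mulmxA -AB_BA mulmxA BAB.
rewrite -mulmxA -AMi [LHS]AMi mulmxBr mulmx1 -scalemxAr; congr (_ - eps *: _).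
by rewrite mulmxA BBA.
Qed.

Lemma ridge_rate (R : realType) (n : nat) (A B : 'M[R]_n) (i j : 'I_n) :
  A^T = A -> sym_pinv A B ->
  exists C : R, forall eps, 0 < eps ->
    `|B i j - (A *m invmx (ridge A eps)) i j| <= eps * C.
Proof.
move=> symA pAB; set D := B *m B *m B.
exists (\sum_k `|D i k| * 2) => eps eps0.
rewrite (ridge_error symA pAB eps0) -/D !mxE opprD opprK addrA subrr add0r.
rewrite normrM gtr0_norm // ler_pM2l //.
apply: le_trans (ler_norm_sum _ _ _) _; apply: ler_sum => k _.
rewrite normrM ler_wpM2l // !mxE; apply: le_trans (ler_normB _ _) _.
(* the two summands are an entry of I and an entry of eps M^-1 *)
rewrite -[leRHS]/(1 + 1) lerD //; last exact: ridge_inv_bound.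
by rewrite normr_nat; case: (k == j).
Qed.

Lemma ridge_cvg (R : realType) (n : nat) (A B : 'M[R]_n) (i j : 'I_n) :
  A^T = A -> sym_pinv A B ->
  (A *m invmx (ridge A lambda^-1)) i j @[lambda --> +oo] --> B i j.
Proof.
move=> symA pAB; have [C rate] := ridge_rate i j symA pAB.
apply/cvgrPdist_le => e e0; near=> lambda.
have lambda0 : 0 < lambda by near: lambda; exact: nbhs_pinfty_gt.
have Ce_le : C / e <= lambda.
  by near: lambda; apply: nbhs_pinfty_ge; exact: num_real.
apply: le_trans (rate _ _) _; first by rewrite invr_gt0.
by rewrite mulrC ler_pdivrMr // mulrC -ler_pdivrMr.
Unshelve. all: by end_near.
Qed.

(** * Adjacency matrices *)

Lemma adjacentC (V : finType) (G : ugraph V) (u w : V) :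
  Defs.adjacent G u w = Defs.adjacent G w u.
Proof. by rewrite /Defs.adjacent finset.setUC. Qed.

Lemma adjacency_mx_sym (R : realType) (V : finType) (G : ugraph V) (n : nat)
    (v : 'I_n -> V) : (adjacency_mx R G v)^T = adjacency_mx R G v.
Proof. by apply/matrixP => i j; rewrite !mxE adjacentC. Qed.

Lemma adjacency_mx_sqr (R : realType) (V : finType) (G : ugraph V) (n : nat)
    (v : 'I_n -> V) (i j : 'I_n) : bijective v ->
  (adjacency_mx R G v *m adjacency_mx R G v) i j =
    #|neighbours G (v i) :&: neighbours G (v j)|%:R.
Proof.
move=> bij_v; rewrite mxE -sum1_card natr_sum (reindex v) /=; last exact: onW_bij.
rewrite [RHS]big_mkcond; apply: eq_bigr => k _.
rewrite !inE !mxE [Defs.adjacent G (v k) _]adjacentC -natrM mulnb.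
by case: (_ && _).
Qed.

Lemma R_mx_ridge (R : realType) (V : finType) (G : ugraph V) (n : nat)
    (v : 'I_n -> V) (lambda : R) : bijective v ->
  R_mx G v lambda = ridge (adjacency_mx R G v) lambda^-1.
Proof.
move=> bij_v; apply/matrixP => i j; rewrite /ridge mxE [RHS]mxE.
rewrite adjacency_mx_sqr // mxE; case: eqP => [->|_]; last by rewrite add0r.
by rewrite finset.setIid.
Qed.

(** [delta_vec] is the i-th row of the adjacency matrix. *)
Lemma inner_delta_vec (R : realType) (V : finType) (G : ugraph V) (n : nat)
    (v : 'I_n -> V) (M : 'M[R]_n) (i j : 'I_n) :
  inner (M *m std_basis R j) (delta_vec R G v i) = (adjacency_mx R G v *m M) i j.
Proof. by rewrite -colE mxE; apply: eq_bigr => k _; rewrite !mxE mulrC. Qed.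

Theorem theorem3p1 (R : realType) (V : finType) (G : ugraph V) (n m : nat)
    (v : 'I_n -> V) (hv : bijective v) (hm : #|edges G| = m) :
  (forall lambda : R, 0 < lambda -> R_mx G v lambda \in unitmx) /\
  (exists S : 'M[R]_n,
     unique (is_moore_penrose (adjacency_mx R G v)) S /\
     forall i j : 'I_n,
       S i j = S j i /\
       inner (invmx (R_mx G v lambda) *m std_basis R j) (delta_vec R G v i)
         @[lambda --> +oo] --> S i j).
Proof.
have symA := adjacency_mx_sym R G v.
split=> [lambda lambda0|].
  by rewrite R_mx_ridge // ridge_unitmx // invr_gt0.
have [S pAS] := sym_pinv_exists symA.
exists S; split=> [|i j]; first exact: sym_pinv_moore_penrose.
have [symS _ _ _] := pAS; split; first by rewrite -{1}symS mxE.
under eq_cvg => lambda do rewrite inner_delta_vec R_mx_ridge //.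
exact: ridge_cvg.
Qed.
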